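(* Consider the online linear regression problem with delayed labels described in the context, and assume $\|z_t\|_2\le Z$ and $|y_t|\le Y$ for all $t\in[T]$, for some $Y,Z\ge0$. Let $0<\eta_0\le\eta_1\le\dots\le\eta_T$. Consider the learner (delayed Vovk–Azoury–Warmuth forecaster with clipping): set $\rho_1=0$; at each round $t$, after observing $z_t$, compute $$x_t=\arg\min_{x\in\mathbb{R}^n}\ \sum_{\tau\in o_t}-y_\tau\langle z_\tau,x\rangle+\frac{\eta_t}{2}\|x\|_2^2+\frac12\sum_{\tau=1}^{t}\langle z_\tau,x\rangle^2,$$ play $\tilde x_t=x_t\cdot\min\left\{\frac{\rho_t}{|\langle z_t,x_t\rangle|},1\right\}$ (with $\tilde x_t=x_t$ if $\langle z_t,x_t\rangle=0$), then receive $y_\tau$ for all $\tau\in o_{t+1}\setminus o_t$ and set $\rho_{t+1}=\max_{\tau\in o_{t+1}}|y_\tau|$ (with $\max\emptyset=0$). Then for every $u\in\mathbb{R}^n$, $$\mathrm{Reg}_T(u)\le\frac{\eta_T}{2}\|u\|_2^2+nY^2\ln\left(1+\frac{Z^2T}{\eta_0 n}\right)+\mathcal{O}\left(Y^2\left(\sigma_{\max}+\min\{M_1,M_2\}\right)\right),$$ where $M_1=n\,d_{\max}\ln\left(1+\frac{Z^2T}{\eta_0 n}\right)$ and $M_2=Z^2\sum_{t=1}^T\frac{|m_t|}{\eta_t}$, and $\mathcal{O}$ hides only an absolute numerical constant.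
   Context: Online linear regression with delayed labels: $T\ge1$, $n\ge1$ integers, $[T]=\{1,\dots,T\}$. At each round $t\in[T]$ the learner first observes a feature vector $z_t\in\mathbb{R}^n$, then plays a point $\tilde x_t\in\mathbb{R}^n$ (unconstrained) and incurs the loss $f_t(\tilde x_t)$ where $f_t(x)=\frac12(\langle z_t,x\rangle-y_t)^2$ for a label $y_t\in\mathbb{R}$; the label $y_t$ is revealed only at the end of round $t+d_t$, where $d_t\in\{0,1,2,\dots\}$ is an arbitrary delay unknown to the learner, with $t+d_t\le T$ for all $t$. For $t\ge1$ define $o_t=\{\tau\in\mathbb{N}:\tau+d_\tau<t\}\subseteq[t-1]$ and $m_t=[t-1]\setminus o_t$; $\sigma_{\max}=\max_{t\in[T]}|m_t|$ and $d_{\max}=\max_{t\in[T]}d_t$. The regret against $u\in\mathbb{R}^n$ is $\mathrm{Reg}_T(u)=\sum_{t=1}^T(f_t(\tilde x_t)-f_t(u))$. The learning rate $\eta_t$ used at round $t$ may depend on the information available at the start of round $t$. *)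

(* Defs.v *)
From mathcomp Require Import all_boot all_order all_algebra.
From mathcomp Require Import reals exp.
Set Implicit Arguments. Unset Strict Implicit. Unset Printing Implicit Defensive.
Import Order.TTheory GRing.Theory Num.Theory.
Local Open Scope ring_scope.

Section Defs.
Variable R : realType.

Definition dotv (n : nat) (u v : 'rV[R]_n) : R := \sum_(i < n) u 0 i * v 0 i.
Definition sqnorm (n : nat) (u : 'rV[R]_n) : R := dotv u u.

(* Rounds are indexed by 1..T; d is the delay sequence. in_o d t tau is used
   only with tau ranging over 1 <= tau < t, so that
   tau \in o_t  <->  1 <= tau /\ tau + d tau < t   (o_t is a subset of [t-1]) *)
Definition in_o (d : nat -> nat) (t tau : nat) : bool := (tau + d tau < t)%N.

Definition card_m (d : nat -> nat) (t : nat) : nat :=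
  #|[set tau : 'I_t | (0 < tau)%N && ~~ in_o d t tau]|.

Definition sigma_max (d : nat -> nat) (T : nat) : nat :=
  \max_(1 <= t < T.+1) card_m d t.

Definition d_max (d : nat -> nat) (T : nat) : nat :=
  \max_(1 <= t < T.+1) d t.

Definition sqloss (n : nat) (z : 'rV[R]_n) (y : R) (x : 'rV[R]_n) : R :=
  (dotv z x - y) ^+ 2 / 2.

Definition vaw_obj (n : nat) (z : nat -> 'rV[R]_n) (y : nat -> R)
    (d : nat -> nat) (eta : nat -> R) (t : nat) (x : 'rV[R]_n) : R :=
  \sum_(1 <= tau < t | in_o d t tau) (- (y tau * dotv (z tau) x))
  + eta t / 2 * sqnorm x
  + (\sum_(1 <= tau < t.+1) dotv (z tau) x ^+ 2) / 2.

Definition rho (y : nat -> R) (d : nat -> nat) (t : nat) : R :=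
  \big[Num.max/0]_(1 <= tau < t | in_o d t tau) `|y tau|.

Definition clip (n : nat) (r : R) (z x : 'rV[R]_n) : 'rV[R]_n :=
  if dotv z x == 0 then x else Num.min (r / `|dotv z x|) 1 *: x.

Definition regret (n T : nat) (z : nat -> 'rV[R]_n) (y : nat -> R)
    (xt : nat -> 'rV[R]_n) (u : 'rV[R]_n) : R :=
  \sum_(1 <= t < T.+1) (sqloss (z t) (y t) (xt t) - sqloss (z t) (y t) u).

End Defs.

(* Main.v *)
(* Write A_t = eta_t I + sum_(tau <= t) z_tau z_tau^T, and let p*_t be the prediction
   of the undelayed forecaster, which knows all labels before round t.

   The undelayed forecaster has regret at most eta_T/2 |u|^2 + Y^2/2 sum_t s_t with
   s_t = z_t^T A_t^-1 z_t, by telescoping the minimal value of the regularized past loss;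
   sum_t s_t <= n L, where L is the logarithm in the statement, follows from
   1 - s_t = det A_(t-1) / det A_t (for constant eta) and det A <= (tr A / n)^n.

   The prediction p_t = <z_t, x_t> differs from p*_t by sum_(tau in m_t) y_tau z_t^T A_t^-1 z_tau.
   Each summand is at most Y Z^2 / eta_t, which gives M_2, and at most Y (s_t + s_tau) / 2,
   which gives M_1.

   Clipping p_t at rho_t instead of at max(rho_t, |y_t|) costs at most
   k (y_t^2 - rho_t^2)^+ / 2 at round t. Here k = a / (1 + a) with a = Z^2 T / eta_0, because
   |p_t| <= a rho_t. These excesses sum to at most (sigma_max + 1) Y^2. Since k <= 1, the part
   sigma_max Y^2 is of the claimed order; since k <= n L, the remaining Y^2 k / 2 is absorbed by
   the logarithmic term, so that no additive Y^2 is left even without delays. *)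

Require Import Defs.
From mathcomp Require Import all_boot all_order all_algebra.
From mathcomp Require Import reals exp.
From mathcomp Require Import ring lra zify.
Import Order.TTheory GRing.Theory Num.Theory.
Local Open Scope ring_scope.
Set Implicit Arguments. Unset Strict Implicit. Unset Printing Implicit Defensive.

(** * Positive definite forms and their inverses *)

Section QuadraticForms.
Variable R : realType.

Lemma dotvE n (u v : 'rV[R]_n) : dotv u v = (u *m v^T) 0 0.
Proof. by rewrite mxE; apply: eq_bigr => i _; rewrite mxE. Qed.

Lemma dotvC n (u v : 'rV[R]_n) : dotv u v = dotv v u.
Proof. by apply: eq_bigr => i _; rewrite mulrC. Qed.

Lemma dotvDl n (u v w : 'rV[R]_n) : dotv (u + v) w = dotv u w + dotv v w.
Proof. by rewrite !dotvE mulmxDl mxE. Qed.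

Lemma dotvZl n a (u v : 'rV[R]_n) : dotv (a *: u) v = a * dotv u v.
Proof. by rewrite !dotvE -scalemxAl mxE. Qed.

Lemma dotvNl n (u v : 'rV[R]_n) : dotv (- u) v = - dotv u v.
Proof. by rewrite -scaleN1r dotvZl mulN1r. Qed.

Lemma dotv0l n (v : 'rV[R]_n) : dotv 0 v = 0.
Proof. by rewrite dotvE mul0mx mxE. Qed.

Lemma dotvDr n (u v w : 'rV[R]_n) : dotv u (v + w) = dotv u v + dotv u w.
Proof. by rewrite dotvC dotvDl ![dotv _ u]dotvC. Qed.

Lemma dotvZr n a (u v : 'rV[R]_n) : dotv u (a *: v) = a * dotv u v.
Proof. by rewrite dotvC dotvZl dotvC. Qed.

Lemma dotvNr n (u v : 'rV[R]_n) : dotv u (- v) = - dotv u v.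
Proof. by rewrite dotvC dotvNl dotvC. Qed.

Lemma dotv_suml n I (r : seq I) (P : pred I) (F : I -> 'rV[R]_n) (v : 'rV[R]_n) :
  dotv (\sum_(i <- r | P i) F i) v = \sum_(i <- r | P i) dotv (F i) v.
Proof. by apply: (big_morph (fun w => dotv w v)) => [u w|]; rewrite ?dotvDl ?dotv0l. Qed.

Lemma dotv_mulmxl m n (u : 'rV[R]_m) (A : 'M_(m, n)) (v : 'rV[R]_n) :
  dotv (u *m A) v = dotv u (v *m A^T).
Proof. by rewrite !dotvE trmx_mul trmxK mulmxA. Qed.

Lemma sqnorm_ge0 n (u : 'rV[R]_n) : 0 <= sqnorm u.
Proof. by apply: sumr_ge0 => i _; rewrite -expr2 sqr_ge0. Qed.

Lemma sqnorm_gt0 n (u : 'rV[R]_n) : u != 0 -> 0 < sqnorm u.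
Proof.
move=> u0; rewrite lt_def sqnorm_ge0 andbT; apply: contra u0 => /eqP.
move/psumr_eq0P => u0; apply/eqP/rowP => i; rewrite mxE.
have /eqP := u0 (fun i _ => sqr_ge0 (u 0 i)) i isT.
by rewrite mulf_eq0 orbb => /eqP.
Qed.

Definition form n (A : 'M[R]_n) (u v : 'rV[R]_n) : R := dotv (u *m A) v.

Definition posdef n (A : 'M[R]_n) : Prop :=
  A^T = A /\ forall u, u != 0 -> 0 < form A u u.

Lemma formDl n (A : 'M[R]_n) u v w : form A (u + v) w = form A u w + form A v w.
Proof. by rewrite /form mulmxDl dotvDl. Qed.

Lemma formDr n (A : 'M[R]_n) u v w : form A u (v + w) = form A u v + form A u w.
Proof. exact: dotvDr. Qed.

Lemma formNl n (A : 'M[R]_n) u w : form A (- u) w = - form A u w.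
Proof. by rewrite /form mulNmx dotvNl. Qed.

Lemma formNr n (A : 'M[R]_n) u w : form A u (- w) = - form A u w.
Proof. exact: dotvNr. Qed.

Lemma formZl n (A : 'M[R]_n) a u w : form A (a *: u) w = a * form A u w.
Proof. by rewrite /form -scalemxAl dotvZl. Qed.

Lemma formZr n (A : 'M[R]_n) a u w : form A u (a *: w) = a * form A u w.
Proof. exact: dotvZr. Qed.

Lemma form_addmx n (A B : 'M[R]_n) u v : form (A + B) u v = form A u v + form B u v.
Proof. by rewrite /form mulmxDr dotvDl. Qed.

Lemma form_scalar n (a : R) (u v : 'rV[R]_n) : form a%:M u v = a * dotv u v.
Proof. by rewrite /form mul_mx_scalar dotvZl. Qed.

Lemma form_outer n (z u v : 'rV[R]_n) : form (z^T *m z) u v = dotv z u * dotv z v.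
Proof.
rewrite /form mulmxA.
have -> : u *m z^T = (dotv z u)%:M by rewrite dotvC dotvE [LHS]mx11_scalar.
by rewrite mul_scalar_mx dotvZl.
Qed.

Lemma formC n (A : 'M[R]_n) u v : A^T = A -> form A u v = form A v u.
Proof. by move=> sA; rewrite /form dotv_mulmxl sA dotvC. Qed.

Lemma posdef_form_ge0 n (A : 'M[R]_n) u : posdef A -> 0 <= form A u u.
Proof.
move=> [_ pA]; have [->|u0] := eqVneq u 0; first by rewrite /form mul0mx dotv0l.
exact/ltW/pA.
Qed.

Lemma posdef_unit n (A : 'M[R]_n) : posdef A -> A \in unitmx.
Proof.
move=> [_ pA]; rewrite -row_free_unit; apply: inj_row_free => v vA.
apply/eqP; apply: contraT => /pA; by rewrite /form vA dotv0l ltxx.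
Qed.

Lemma trmx_invmx n (A : 'M[R]_n) : A^T = A -> (invmx A)^T = invmx A.
Proof. by move=> sA; rewrite trmx_inv sA. Qed.

Lemma form_invmx n (A : 'M[R]_n) u : posdef A ->
  form (invmx A) u u = form A (u *m invmx A) (u *m invmx A).
Proof. by move=> pA; rewrite {2}/form (mulmxKV (posdef_unit pA)) dotvC. Qed.

Lemma posdef_inv n (A : 'M[R]_n) : posdef A -> posdef (invmx A).
Proof.
move=> pA; split; first exact/trmx_invmx/(proj1 pA).
move=> u u0; rewrite form_invmx //; apply: (proj2 pA).
apply: contra u0 => /eqP h; apply/eqP.
by rewrite -[u](mulmxKV (posdef_unit pA)) h mul0mx.
Qed.

Lemma form_completed_square n (A : 'M[R]_n) v x : posdef A ->
  form A (x - v *m invmx A) (x - v *m invmx A)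
  = form A x x - 2 * dotv v x + form (invmx A) v v.
Proof.
move=> pA; rewrite form_invmx //; set w := v *m invmx A.
have wx : form A w x = dotv v x by rewrite /form (mulmxKV (posdef_unit pA)).
rewrite formDl !formDr !formNl !formNr (formC x w (proj1 pA)) wx; ring.
Qed.

(** Fenchel-Young inequality: the right side is the maximum of the left over [x], attained at
    [v *m invmx A]. It follows by dropping the completed square. *)
Lemma form_inv_ge n (A : 'M[R]_n) v x : posdef A ->
  2 * dotv v x - form A x x <= form (invmx A) v v.
Proof.
move=> pA; have := posdef_form_ge0 (x - v *m invmx A) pA.
rewrite form_completed_square //; lra.
Qed.

Lemma quadratic_argmin n (A : 'M[R]_n) v x : posdef A ->
  (forall x', form A x x - 2 * dotv v x <= form A x' x' - 2 * dotv v x') ->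
  x = v *m invmx A.
Proof.
move=> pA /(_ (v *m invmx A)) min_x; apply/eqP; rewrite -subr_eq0.
apply: contraT => /(proj2 pA); rewrite form_completed_square //.
have := form_completed_square v (v *m invmx A) pA.
by rewrite subrr {1}/form mul0mx dotv0l; lra.
Qed.

(** Both sides are maxima of [2 * dotv v x] minus the respective form. The point attaining the one
    for [B] does at least as well for the smaller [A]. *)
Lemma form_inv_anti n (A B : 'M[R]_n) v : posdef A -> posdef B ->
  (forall x, form A x x <= form B x x) -> form (invmx B) v v <= form (invmx A) v v.
Proof.
move=> pA pB AB; have := form_inv_ge v (v *m invmx B) pA.
have := AB (v *m invmx B); rewrite -form_invmx // dotvC -/(form _ v v); lra.
Qed.

(** The forms at [u + v] and [u - v] are nonnegative. The additive form lets the two leverages be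
    summed separately later. *)
Lemma posdef_cauchy n (A : 'M[R]_n) u v : posdef A ->
  `|form A u v| <= (form A u u + form A v v) / 2.
Proof.
move=> pA; rewrite ler_norml.
have := posdef_form_ge0 (u + v) pA; have := posdef_form_ge0 (u - v) pA.
rewrite !formDl !formDr !formNl !formNr (formC v u (proj1 pA)); lra.
Qed.

Lemma posdef_scalar n (a : R) : 0 < a -> posdef (a%:M : 'M_n).
Proof.
move=> a0; split; first exact: tr_scalar_mx.
by move=> u u0; rewrite form_scalar mulr_gt0 ?sqnorm_gt0.
Qed.

Lemma invmx_scalar n (a : R) : a != 0 -> invmx (a%:M : 'M_n) = a^-1%:M.
Proof.
move=> a0.
have aU : (a%:M : 'M[R]_n) \in unitmx by rewrite unitmxE det_scalar unitfE expf_neq0.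
by apply: (can_inj (mulmxK aU)); rewrite mulVmx // -scalar_mxM mulVf.
Qed.

Lemma posdef_outer n (A : 'M[R]_n) (z : 'rV_n) : posdef A -> posdef (A + z^T *m z).
Proof.
move=> [sA pA]; split; first by rewrite linearD /= trmx_mul trmxK sA.
by move=> u u0; rewrite form_addmx form_outer ltr_wpDr ?pA // -expr2 sqr_ge0.
Qed.

End QuadraticForms.

(** * Rank-one determinant updates and Hadamard's inequality *)

Section Determinants.
Variable R : realType.

(** Eliminating either diagonal block of the block matrix [M] gives a triangular factorization; the
    two resulting determinants agree. *)
Lemma det_1sub_outer n (a : 'cV[R]_n) (b : 'rV[R]_n) :
  \det (1%:M - a *m b) = 1 - (b *m a) 0 0.
Proof.
pose M := block_mx (1%:M : 'M[R]_1) b a 1%:M.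
have M1 : M = block_mx 1%:M 0 a 1%:M *m block_mx 1%:M b 0 (1%:M - a *m b).
  by rewrite mulmx_block !mul1mx !mul0mx !mulmx1 !addr0 addrC subrK.
have M2 : M = block_mx (1%:M - b *m a) b 0 1%:M *m block_mx 1%:M 0 a 1%:M.
  by rewrite mulmx_block !mul1mx !mul0mx !mulmx1 !mulmx0 !add0r subrK.
have : \det M = \det M by [].
rewrite {1}M1 M2 !det_mulmx !det_lblock !det_ublock !det1 !mul1r !mulr1 => ->.
by rewrite {1}[1%:M - _]mx11_scalar det_scalar1 !mxE eqxx.
Qed.

Lemma det_sub_outer n (A : 'M[R]_n) (z : 'rV_n) : A \in unitmx ->
  \det (A - z^T *m z) = \det A * (1 - form (invmx A) z z).
Proof.
move=> uA; have -> : A - z^T *m z = A *m (1%:M - invmx A *m z^T *m z).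
  by rewrite mulmxBr mulmx1 !mulmxA mulmxV // mul1mx.
by rewrite det_mulmx det_1sub_outer /form dotvE !mulmxA.
Qed.

Lemma dotv_row_mx m n (u1 v1 : 'rV[R]_m) (u2 v2 : 'rV[R]_n) :
  dotv (row_mx u1 u2) (row_mx v1 v2) = dotv u1 v1 + dotv u2 v2.
Proof. by rewrite !dotvE tr_row_mx mul_row_col mxE. Qed.

Lemma dotv_rV1 (u v : 'rV[R]_1) : dotv u v = u 0 0 * v 0 0.
Proof. by rewrite /dotv big_ord1. Qed.

(* Induction through the Schur complement, whose diagonal is dominated by that
   of the original matrix. *)
Lemma hadamard n (A : 'M[R]_n) : posdef A -> 0 < \det A <= \prod_i A i i.
Proof.
elim: n A => [|n IHn] A pA; first by rewrite det_mx00 big_ord0 lexx ltr01.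
rewrite -[n.+1]/(1 + n)%N in A pA *.
pose a := A 0 0; pose r : 'rV[R]_n := ursubmx A; pose D : 'M[R]_n := drsubmx A.
have a_gt0 : 0 < a.
  have d0 : delta_mx 0 0 != 0 :> 'rV[R]_(1 + n).
    by apply/eqP => /rowP /(_ 0) /eqP; rewrite !mxE eqxx oner_eq0.
  have := proj2 pA _ d0; rewrite /form -rowE dotvE.
  by rewrite trmx_delta -colE !mxE.
have a0 : a != 0 by rewrite gt_eqF.
have sD : D^T = D by rewrite /D trmx_drsub (proj1 pA).
have ulA : ulsubmx A = a%:M.
  by rewrite [LHS]mx11_scalar !mxE /a; congr (A _ _)%:M; apply/val_inj.
have eA : A = block_mx a%:M r r^T D.
  by rewrite -[LHS]submxK ulA /r trmx_ursub (proj1 pA).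
pose S := D - a^-1 *: (r^T *m r).
have eM : A = block_mx 1%:M 0 (a^-1 *: r^T) 1%:M *m block_mx a%:M r 0 S.
  rewrite mulmx_block !mul1mx !mul0mx !addr0 mul_mx_scalar scalerA mulfV //.
  by rewrite scale1r -scalemxAl [_ + S]addrC subrK.
have formS v : form S v v = form D v v - a^-1 * dotv r v ^+ 2.
  by rewrite expr2 -form_outer /S form_addmx /form mulmxN dotvNl -scalemxAr dotvZl.
have pS : posdef S.
  split=> [|v v0].
    by rewrite /S linearB /= linearZ /= trmx_mul trmxK sD.
  (* This first coordinate minimizes the form of [A] among vectors ending in [v]; the minimum is the
     form of [S] at [v]. *)
  pose w : 'rV[R]_(1 + n) := row_mx (- (dotv r v / a))%:M v.
  have w0 : w != 0.
    apply: contra v0 => /eqP w0; apply/eqP.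
    by rewrite -[v](row_mxKr (- (dotv r v / a))%:M) -/w w0 linear0.
  have h := proj2 pA w w0; rewrite formS; apply: lt_le_trans h _.
  rewrite {1}/form eA mul_row_block dotv_row_mx dotv_rV1 dotvDl !mul_scalar_mx dotvZl.
  rewrite -/(form D v v).
  rewrite mxE -dotvE [dotv v r]dotvC !mxE !mulr1n le_eqVlt; apply/orP; left; apply/eqP.
  by field.
have /andP[S0 SD] := IHn S pS.
have dA : \det A = a * \det S.
  by rewrite eM det_mulmx det_lblock det_ublock !det1 !mul1r det_scalar1.
rewrite dA mulr_gt0 //= big_split_ord big_ord1 /=.
have -> : A (lshift n 0) (lshift n 0) = a by rewrite eA block_mxEul mxE eqxx.
rewrite ler_pM2l //; apply: le_trans SD _; apply: ler_prod => i _.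
have eS : S i i = D i i - a^-1 * (r 0 i) ^+ 2.
  by rewrite /S !mxE big_ord1 !mxE expr2.
apply/andP; split.
  have := posdef_form_ge0 (delta_mx 0 i) pS.
  by rewrite /form -rowE dotvE trmx_delta -colE !mxE.
by rewrite eS eA block_mxEdr gerBl mulr_ge0 ?sqr_ge0 // invr_ge0 (ltW a_gt0).
Qed.

(** AM-GM on the diagonal entries, whose product dominates the determinant. *)
Lemma det_le_trace n (A : 'M[R]_n) : posdef A -> \det A <= (\tr A / n%:R) ^+ n.
Proof.
move=> pA; have /andP[_ dA] := hadamard pA; apply: le_trans dA _.
have diag_ge0 i : 0 <= A i i.
  have := posdef_form_ge0 (delta_mx 0 i) pA.
  by rewrite /form -rowE dotvE trmx_delta -colE !mxE.
have := leif_AGM (A := [pred _ : 'I_n | true]) (E := fun i => A i i) (fun i _ => diag_ge0 i).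
by case=> + _; rewrite card_ord.
Qed.

End Determinants.

(** * Regularized Gram matrices and the undelayed forecaster *)

Section Gram.
Variables (R : realType) (n : nat) (z : nat -> 'rV[R]_n).

Definition gram (e : R) (t : nat) : 'M[R]_n :=
  e%:M + \sum_(1 <= tau < t.+1) (z tau)^T *m z tau.

Lemma gram0 e : gram e 0 = e%:M.
Proof. by rewrite /gram big_geq // addr0. Qed.

Lemma gramS e t : gram e t.+1 = gram e t + (z t.+1)^T *m z t.+1.
Proof. by rewrite /gram [in LHS]big_nat_recr //= addrA. Qed.

Lemma posdef_gram e t : 0 < e -> posdef (gram e t).
Proof.
move=> e0; elim: t => [|t IHt]; first by rewrite gram0; apply: posdef_scalar.
by rewrite gramS; apply: posdef_outer.
Qed.

Lemma form_gram e t u :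
  form (gram e t) u u = e * sqnorm u + \sum_(1 <= tau < t.+1) dotv (z tau) u ^+ 2.
Proof.
elim: t => [|t IHt]; first by rewrite gram0 form_scalar big_geq // addr0.
by rewrite gramS form_addmx form_outer IHt [in RHS]big_nat_recr //= addrA expr2.
Qed.

Lemma tr_gram e t :
  \tr (gram e t) = e * n%:R + \sum_(1 <= tau < t.+1) sqnorm (z tau).
Proof.
elim: t => [|t IHt]; first by rewrite gram0 mxtrace_scalar big_geq // addr0 mulr_natr.
rewrite gramS mxtraceD mxtrace_mulC IHt [in RHS]big_nat_recr //= addrA; congr (_ + _).
by rewrite [_ *m _]mx11_scalar mxtrace_scalar mulr1n /sqnorm dotvE.
Qed.

Lemma form_gram_le e e' t t' u : e <= e' -> (t <= t')%N ->
  form (gram e t) u u <= form (gram e' t') u u.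
Proof.
move=> ee' tt'; rewrite !form_gram lerD ?ler_wpM2r ?sqnorm_ge0 //.
rewrite [leRHS](big_cat_nat (n := t.+1)) //= lerDl sumr_ge0 // => i _; exact: sqr_ge0.
Qed.

Lemma form_inv_gram_le e e' t t' u : 0 < e -> e <= e' -> (t <= t')%N ->
  form (invmx (gram e' t')) u u <= form (invmx (gram e t)) u u.
Proof.
move=> e0 ee' tt'; apply: form_inv_anti => [||x]; last exact: form_gram_le.
- exact: posdef_gram.
- exact/posdef_gram/(lt_le_trans e0).
Qed.

Lemma form_inv_gram_sqnorm e t u : 0 < e ->
  form (invmx (gram e t)) u u <= sqnorm u / e.
Proof.
move=> e0; apply: le_trans (form_inv_gram_le u e0 (lexx e) (leq0n t)) _.
by rewrite gram0 invmx_scalar ?gt_eqF // form_scalar mulrC.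
Qed.

(** With [s] the left side, the determinant ratio of consecutive Gram matrices is [1 - s], and
    [s <= - ln (1 - s)]. *)
Lemma form_inv_gram_det e t : 0 < e ->
  form (invmx (gram e t.+1)) (z t.+1) (z t.+1)
  <= ln (\det (gram e t.+1)) - ln (\det (gram e t)).
Proof.
move=> e0; have pA := posdef_gram t.+1 e0.
have /andP[D1 _] := hadamard pA.
have /andP[D0 _] := hadamard (posdef_gram t e0).
have : \det (gram e t) = \det (gram e t.+1 - (z t.+1)^T *m z t.+1).
  by rewrite gramS addrK.
rewrite det_sub_outer ?posdef_unit // => dE.
move: D0; rewrite dE pmulr_rgt0 // => x_lt1.
rewrite lnM ?posrE // opprD addNKr.
by have := @le_ln1Dx _ (- form (invmx (gram e t.+1)) (z t.+1) (z t.+1)); lra.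
Qed.

(** The log-determinants telescope from [n * ln e]. The final trace is at most [c * e * n], with [c]
    the argument of the logarithm, so the final determinant is at most [(c * e) ^+ n]. *)
Lemma elliptical_potential e Z2 T : (0 < n)%N -> 0 < e -> 0 <= Z2 ->
  (forall t, (1 <= t <= T)%N -> sqnorm (z t) <= Z2) ->
  \sum_(1 <= t < T.+1) form (invmx (gram e t)) (z t) (z t)
  <= n%:R * ln (1 + Z2 * T%:R / (e * n%:R)).
Proof.
move=> n0 e0 Z20 zZ; have n0' : 0 < n%:R :> R by rewrite ltr0n.
have sum_le : \sum_(1 <= t < T.+1) form (invmx (gram e t)) (z t) (z t)
    <= ln (\det (gram e T)) - ln (\det (gram e 0)).
  elim: T {zZ} => [|T IHT]; first by rewrite big_geq // subrr.
  rewrite big_nat_recr //=; have := form_inv_gram_det T e0; lra.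
apply: le_trans sum_le _; have pT := posdef_gram T e0.
have /andP[D0 _] := hadamard pT.
set c := 1 + _; have c1 : 1 <= c.
  by rewrite /c lerDl divr_ge0 ?mulr_ge0 // ltW.
have c0 : 0 < c := lt_le_trans ltr01 c1.
rewrite gram0 det_scalar lnXn // lerBlDr -[ln e *+ n]mulr_natl -mulrDr.
rewrite -lnM ?posrE // mulr_natl -lnXn ?mulr_gt0 // ler_ln ?posrE ?exprn_gt0 ?mulr_gt0 //.
apply: le_trans (det_le_trace pT) _.
have tr0 : 0 <= \tr (gram e T).
  rewrite tr_gram addr_ge0 ?mulr_ge0 // ?(ltW e0) //.
  by apply: sumr_ge0 => i _; apply: sqnorm_ge0.
rewrite lerXn2r ?nnegrE ?divr_ge0 ?mulr_ge0 ?(ltW e0) ?(ltW c0) //.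
rewrite ler_pdivrMr // tr_gram.
have -> : c * e * n%:R = e * n%:R + Z2 * T%:R.
  by rewrite /c; field; rewrite !gt_eqF.
rewrite lerD2l; apply: le_trans (_ : \sum_(1 <= t < T.+1) Z2 <= _).
  by apply: ler_sum_nat => t /andP[t1 tT]; apply: zZ; rewrite t1.
by rewrite sumr_const_nat subSS subn0 mulr_natr.
Qed.

Variables (y eta : nat -> R).

Definition target (t : nat) : 'rV[R]_n := \sum_(1 <= tau < t) y tau *: z tau.

Definition vaw_pred (t : nat) : R :=
  form (invmx (gram (eta t) t)) (target t) (z t).

Definition leverage (t : nat) : R := form (invmx (gram (eta t) t)) (z t) (z t).

(** The right side is the minimal value of the regularized squared loss over the first [T] rounds.
    The induction shows that each round raises it by at least that round's summand on the left. *)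
Lemma vaw_potential T : 0 < eta 0%N ->
  (forall t, (t < T)%N -> eta t <= eta t.+1) ->
  \sum_(1 <= t < T.+1) ((vaw_pred t - y t) ^+ 2 / 2 - y t ^+ 2 / 2 * leverage t)
  <= \sum_(1 <= t < T.+1) y t ^+ 2 / 2
     - form (invmx (gram (eta T) T)) (target T.+1) (target T.+1) / 2.
Proof.
move=> eta0; elim: T => [|T IHT] eta_le.
  by rewrite !big_geq // /target big_geq // /form mul0mx dotv0l mul0r subrr.
have etaT t : (t <= T.+1)%N -> 0 < eta t.
  elim: t => // t IHt tT; exact: lt_le_trans (IHt (ltnW tT)) (eta_le t tT).
have {}IHT := IHT (fun t tT => eta_le t (ltnW tT)).
have targetS : target T.+2 = target T.+1 + y T.+1 *: z T.+1 by rewrite /target big_nat_recr.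
rewrite !(@big_nat_recr _ _ _ T.+1) //= targetS.
set B := target T.+1 in IHT *; set Bz := B + _.
have pA := posdef_gram T.+1 (etaT T.+1 (leqnn _)).
have pA' := posdef_gram T (etaT T (leqnSn _)).
set A := gram (eta T.+1) T.+1 in pA *; set A' := gram (eta T) T in IHT pA'.
have AA' x : form A' x x + dotv (z T.+1) x ^+ 2 <= form A x x.
  rewrite /A gramS form_addmx form_outer expr2 lerD2r.
  by apply: form_gram_le => //; apply: eta_le.
(* Testing the maximum for [A'] at the maximizer for [A] shows that the form of [invmx A'] at [B]
   exceeds that of [invmx A] by at least the squared prediction. *)
have := form_inv_ge B (B *m invmx A) pA'.
have := AA' (B *m invmx A); rewrite -form_invmx // [dotv B _]dotvC -/(form _ B B).
rewrite [dotv (z _) _]dotvC -/(form _ B _).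
have -> : form (invmx A) B (z T.+1) = vaw_pred T.+1 by [].
have eBz : form (invmx A) Bz Bz = form (invmx A) B B + 2 * y T.+1 * vaw_pred T.+1
    + y T.+1 ^+ 2 * leverage T.+1.
  rewrite /Bz formDl !formDr (formC (_ *: _) B (trmx_invmx (proj1 pA))).
  rewrite !formZl !formZr /vaw_pred /leverage -/A -/B; ring.
rewrite eBz; move: IHT; lra.
Qed.

(** The minimal value in [vaw_potential] is at most the regularized loss of [u]. *)
Lemma vaw_regret T u : 0 < eta 0%N ->
  (forall t, (t < T)%N -> eta t <= eta t.+1) ->
  \sum_(1 <= t < T.+1) ((vaw_pred t - y t) ^+ 2 / 2 - sqloss (z t) (y t) u)
  <= eta T / 2 * sqnorm u + \sum_(1 <= t < T.+1) y t ^+ 2 / 2 * leverage t.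
Proof.
move=> eta0 eta_le; have := vaw_potential eta0 eta_le.
have etaT t : (t <= T)%N -> 0 < eta t.
  elim: t => // t IHt tT; exact: lt_le_trans (IHt (ltnW tT)) (eta_le t tT).
have := form_inv_ge (target T.+1) u (posdef_gram T (etaT T (leqnn _))).
rewrite form_gram /target dotv_suml.
rewrite !(big_split, sumrN) /=.
have -> : \sum_(1 <= t < T.+1) sqloss (z t) (y t) u =
  (\sum_(1 <= t < T.+1) dotv (z t) u ^+ 2) / 2
  - \sum_(1 <= t < T.+1) dotv (y t *: z t) u + \sum_(1 <= t < T.+1) y t ^+ 2 / 2.
  rewrite mulr_suml -sumrN -!big_split /=; apply: eq_bigr => t _.
  by rewrite /sqloss dotvZl; field.
lra.
Qed.

End Gram.

(** * The cost of clipping in a single round *)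

Section Clipping.
Variable R : realType.

Lemma dotv_clip n r (z x : 'rV[R]_n) :
  dotv z (clip r z x) =
  if dotv z x == 0 then 0 else Num.min (r / `|dotv z x|) 1 * dotv z x.
Proof. by rewrite /clip; case: ifP => [/eqP|_] //; rewrite dotvZr. Qed.

Lemma dotv_clip_id n r (z x : 'rV[R]_n) : `|dotv z x| <= r ->
  dotv z (clip r z x) = dotv z x.
Proof.
rewrite dotv_clip; case: eqVneq => [-> //|p0 pr].
by rewrite min_r ?mul1r // ler_pdivlMr ?normr_gt0 // mul1r.
Qed.

Lemma dotv_clip_out n r (z x : 'rV[R]_n) : 0 <= r -> r < `|dotv z x| ->
  dotv z (clip r z x) = Num.sg (dotv z x) * r.
Proof.
move=> r0 rp; have p0 : 0 < `|dotv z x| := le_lt_trans r0 rp.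
rewrite dotv_clip ifF; last by apply/negbTE; rewrite -normr_gt0.
rewrite min_l; last by rewrite ler_pdivrMr // mul1r ltW.
by rewrite {2}[dotv z x]numEsg; field; rewrite -normr_gt0 normr_id.
Qed.

(** The difference of squares is [2 * (q - y) * (q - ps) - (q - ps) ^+ 2]. Discarding the last
    square leaves [ps] free to be unbounded. *)
Lemma sq_dist_perturb (y q ps Y : R) : `|y| <= Y -> `|q| <= Y ->
  (q - y) ^+ 2 <= (ps - y) ^+ 2 + 4 * Y * `|q - ps|.
Proof.
move=> yY qY; have qy : `|q - y| <= 2 * Y.
  by apply: le_trans (ler_normB _ _) _; lra.
have : (q - y) * (q - ps) <= 2 * Y * `|q - ps|.
  by apply: le_trans (ler_norm _) _; rewrite normrM ler_wpM2r.
have := sqr_ge0 (q - ps); nra.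
Qed.

(* Both 1 - r/q <= a/(1+a) and q (2y - r - q) <= y^2 - r^2 hold, the latter because
   the difference is (y - q)^2 + r (q - r). *)
Lemma clip_gain (r q y a : R) : 0 <= r -> r < q -> q <= y -> q <= a * r -> 0 <= a ->
  (r - y) ^+ 2 <= (q - y) ^+ 2 + a / (1 + a) * (y ^+ 2 - r ^+ 2).
Proof.
move=> r0 rq qy qa a0; set k := a / (1 + a).
have kE : k * (1 + a) = a by rewrite /k; field; lra.
have k0 : 0 <= k by rewrite divr_ge0 //; lra.
have qk : q - r <= k * q.
  rewrite -(ler_pM2r (_ : 0 < 1 + a)); last lra.
  by rewrite mulrAC kE; lra.
have q2 : q * (2 * y - r - q) <= y ^+ 2 - r ^+ 2.
  have : 0 <= r * (q - r) by rewrite mulr_ge0 // subr_ge0 ltW.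
  have := sqr_ge0 (y - q); lra.
have h1 : (q - r) * (2 * y - r - q) <= k * q * (2 * y - r - q).
  by rewrite ler_wpM2r //; lra.
have h2 : k * (q * (2 * y - r - q)) <= k * (y ^+ 2 - r ^+ 2) by rewrite ler_wpM2l.
lra.
Qed.

(** If [y <= r], clipping moves the prediction towards [y] and costs nothing extra. If [r < y], the
    clipped value [r] is compared by [clip_gain] with the smaller of [p] and [y]. *)
Lemma clip_loss_pos (r y p ps Y a : R) : 0 <= r -> r <= Y -> `|y| <= Y ->
  r < p -> p <= a * r -> 0 <= a ->
  (r - y) ^+ 2 <= (ps - y) ^+ 2 + 4 * Y * `|p - ps|
    + a / (1 + a) * Num.max 0 (y ^+ 2 - r ^+ 2).
Proof.
move=> r0 rY yY rp pa a0; set k := a / (1 + a).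
have k0 : 0 <= k by rewrite divr_ge0 //; lra.
have max0 : 0 <= k * Num.max 0 (y ^+ 2 - r ^+ 2) by rewrite mulr_ge0 // le_max lexx.
have Y0 : 0 <= Y := le_trans r0 rY.
have err0 : 0 <= 4 * Y * `|p - ps| by rewrite !mulr_ge0.
have [yr|ry] := leP y r.
  (* Either [r] lies between [y] and [ps], or [ps < r < p] and [r] is closer to [ps] than [p] is. *)
  have [rps|psr] := leP r ps.
    have : (r - y) ^+ 2 <= (ps - y) ^+ 2 by rewrite ler_sqr ?nnegrE; lra.
    lra.
  have := @sq_dist_perturb y r ps Y yY; rewrite ger0_norm // => /(_ rY).
  have : `|r - ps| <= `|p - ps| by rewrite !ger0_norm; lra.
  by move=> /(ler_wpM2l (mulr_ge0 (ler0n _ 4) Y0)); lra.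
have maxE : Num.max 0 (y ^+ 2 - r ^+ 2) = y ^+ 2 - r ^+ 2.
  by rewrite max_r // subr_ge0 ler_sqr ?nnegrE; lra.
have yY' : y <= Y := le_trans (ler_norm _) yY.
rewrite maxE in max0 *; have [py|yp] := leP p y.
  have pY : `|p| <= Y by rewrite ger0_norm; lra.
  have := sq_dist_perturb ps yY pY; have := clip_gain r0 rp py pa a0.
  rewrite -/k; lra.
have := @clip_gain r y y a r0 ry (lexx y) (le_trans (ltW yp) pa) a0.
rewrite -/k subrr expr0n /=; have := sqr_ge0 (ps - y); lra.
Qed.

Lemma clip_loss n (z x : 'rV[R]_n) (r y ps Y a : R) :
  0 <= r -> r <= Y -> `|y| <= Y -> `|dotv z x| <= a * r -> 0 <= a ->
  (dotv z (clip r z x) - y) ^+ 2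
  <= (ps - y) ^+ 2 + 4 * Y * `|dotv z x - ps|
     + a / (1 + a) * Num.max 0 (y ^+ 2 - r ^+ 2).
Proof.
move=> r0 rY yY pa a0; have [pr|rp] := leP `|dotv z x| r.
  rewrite dotv_clip_id // ler_wpDr //.
    by rewrite mulr_ge0 ?le_max ?lexx // divr_ge0 // addr_ge0.
  exact/sq_dist_perturb/(le_trans pr rY).
rewrite dotv_clip_out //; have [p0|p0] := leP 0 (dotv z x).
  rewrite ger0_norm // in rp pa.
  by rewrite gtr0_sg ?(le_lt_trans r0) // mul1r; apply: clip_loss_pos.
rewrite ltr0_norm // in rp pa; rewrite ltr0_sg // mulN1r.
have yY' : `|- y| <= Y by rewrite normrN.
(* A negative prediction reduces to a positive one by changing the signs of label and
   predictions. *)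
have := @clip_loss_pos r (- y) _ (- ps) Y a r0 rY yY' rp pa a0.
rewrite -(opprD (dotv z x) (- ps)) normrN sqrrN.
by rewrite -(sqrrN (- r - y)) -(sqrrN (ps - y)) !opprB !opprK [y + r]addrC [- ps + y]addrC.
Qed.

End Clipping.

(** * Counting missing labels *)

Section Delays.
Variables (R : realType) (d : nat -> nat).

Lemma card_mE t : card_m d t = (\sum_(1 <= tau < t | ~~ in_o d t tau) 1)%N.
Proof.
rewrite /card_m -sum1_card; case: t => [|t].
  by rewrite big_geq // big1 // => -[].
rewrite big_mkcond [RHS]big_mkcond /= big_ord_recl inE /= add0n.
rewrite big_add1 /= big_mkord; apply: eq_bigr => i _.
by rewrite inE.
Qed.

Lemma card_m_sum t (a : R) :
  \sum_(1 <= tau < t | ~~ in_o d t tau) a = (card_m d t)%:R * a.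
Proof.
rewrite card_mE natr_sum mulr_suml; apply: eq_bigr => i _; by rewrite mul1r.
Qed.

Lemma card_m_le_sigma T t : (1 <= t <= T)%N -> (card_m d t <= sigma_max d T)%N.
Proof.
move=> tT; rewrite /sigma_max; apply: (leq_bigmax_seq t) => //.
by rewrite mem_index_iota ltnS.
Qed.

Lemma delay_le_d_max T t : (1 <= t <= T)%N -> (d t <= d_max d T)%N.
Proof.
by move=> tT; apply: (leq_bigmax_seq t) => //; rewrite mem_index_iota ltnS.
Qed.

Lemma card_m_le_d_max T t : (1 <= t <= T)%N -> (card_m d t <= d_max d T)%N.
Proof.
move=> /andP[t1 tT]; rewrite card_mE; set D := d_max d T.
rewrite -[leqRHS](size_iota (t - D)) -big_filter sum1_size.
(* The missing rounds lie in the window of length [D] starting at [t - D]; if [t < D], truncated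
   subtraction starts it at 0, which still suffices. *)
apply: uniq_leq_size; first by rewrite filter_uniq ?iota_uniq.
move=> tau; rewrite mem_filter mem_iota mem_index_iota /in_o => /andP[h /andP[tau1 taut]].
have := @delay_le_d_max T tau; rewrite tau1 (leq_trans (ltnW taut) tT) => /(_ isT).
rewrite -/D; lia.
Qed.

(** After exchanging the sums, [s tau] is counted only for the [t] with [tau < t <= tau + d tau]. *)
Lemma sum_missing_le T (s : nat -> R) :
  (forall t, (1 <= t <= T)%N -> 0 <= s t) ->
  \sum_(1 <= t < T.+1) \sum_(1 <= tau < t | ~~ in_o d t tau) s tau
  <= (d_max d T)%:R * \sum_(1 <= t < T.+1) s t.
Proof.
move=> s0.
rewrite (eq_big_nat _ _ (F2 := fun t => \sum_(1 <= tau < T.+1)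
    if (tau < t)%N && ~~ in_o d t tau then s tau else 0)); last first.
  move=> t /andP[t1 tT]; rewrite [RHS](big_cat_nat (n := t)) //=; last exact: ltnW.
  rewrite [X in _ = _ + X]big_nat [X in _ = _ + X]big1 ?addr0; last first.
    by move=> tau /andP[h _]; rewrite ltnNge h.
  rewrite big_mkcond; apply: eq_big_nat => tau /andP[_ h].
  by rewrite h.
rewrite exchange_big_nat /= mulr_sumr; apply: ler_sum_nat => tau /andP[tau1 tauT].
have st := s0 tau; rewrite tau1 -ltnS tauT in st.
apply: (@le_trans _ _ ((d tau)%:R * s tau)); last first.
  by rewrite ler_wpM2r ?st // ler_nat; apply: delay_le_d_max; rewrite tau1.
rewrite -big_mkcond big_nat_cond /=.
have -> : \sum_(1 <= i < T.+1 | (1 <= i < T.+1)%N && ((tau < i)%N && ~~ in_o d i tau)) s tau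
   = (\sum_(1 <= i < T.+1 | (tau < i <= tau + d tau)%N) 1)%N%:R * s tau.
  rewrite natr_sum mulr_suml [RHS]big_nat_cond; apply: eq_big => [i|i _]; last by rewrite mul1r.
  by rewrite /in_o -leqNgt.
rewrite ler_wpM2r ?st // ler_nat.
rewrite -[leqRHS](size_iota tau.+1) -big_filter sum1_size.
apply: uniq_leq_size; first by rewrite filter_uniq ?iota_uniq.
by move=> i; rewrite mem_filter mem_iota => /andP[] /andP[h1 h2] _; rewrite h1 /= addSn ltnS.
Qed.

(* The proof bounds the partial sum by the potential
   (sigma + 1) r_t + \sum_(tau in m_t) (w_tau - r_t)^+. *)
Lemma sum_unseen_excess T (w r : nat -> R) (W : R) :
  (forall t, (1 <= t <= T)%N -> (t + d t <= T)%N) ->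
  (forall t, (1 <= t <= T)%N -> r t <= r t.+1) ->
  (forall t tau, (1 <= tau < t)%N -> in_o d t tau -> w tau <= r t) ->
  0 <= r 1%N -> r T.+1 <= W ->
  \sum_(1 <= t < T.+1) Num.max 0 (w t - r t) <= (sigma_max d T).+1%:R * W.
Proof.
move=> dT r_le w_le r1 rW; set s := sigma_max d T.
pose pot t : R := s.+1%:R * r t
  + \sum_(1 <= tau < t | ~~ in_o d t tau) Num.max 0 (w tau - r t).
suff pot_le k : (k <= T)%N -> \sum_(1 <= t < k.+1) Num.max 0 (w t - r t) <= pot k.+1.
  (* Every label has arrived before round [T.+1], so the sum in the potential is empty there. *)
  apply: le_trans (pot_le T (leqnn T)) _; rewrite /pot big_nat_cond big1 ?addr0 ?ler_wpM2l //.
  by move=> t /andP[/dT tT]; rewrite /in_o ltnS tT.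
elim: k => [|k IHk] kT.
  by rewrite big_geq // /pot big_geq // addr0 mulr_ge0.
rewrite big_nat_recr //=; apply: le_trans (lerD (IHk (ltnW kT)) (lexx _)) _.
have rk : r k.+1 <= r k.+2 by apply: r_le.
have -> : pot k.+1 + Num.max 0 (w k.+1 - r k.+1) = s.+1%:R * r k.+1
    + \sum_(1 <= tau < k.+2 | ~~ in_o d k.+1 tau) Num.max 0 (w tau - r k.+1).
  rewrite /pot -addrA [in RHS]big_mkcond big_nat_recr //= -big_mkcond.
  by rewrite ifT // /in_o -leqNgt leq_addr.
(* Raising the threshold lowers each excess by at most the increase of [r], and labels that arrive
   have no excess left. At most [s.+1] terms are affected, the extra one being round [k.+1] itself;
   the increase of [s.+1%:R * r] pays for them. *)
have step : \sum_(1 <= tau < k.+2 | ~~ in_o d k.+1 tau) Num.max 0 (w tau - r k.+1)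
    <= \sum_(1 <= tau < k.+2 | ~~ in_o d k.+1 tau) (r k.+2 - r k.+1)
     + \sum_(1 <= tau < k.+2 | ~~ in_o d k.+2 tau) Num.max 0 (w tau - r k.+2).
  rewrite !(big_mkcond (fun tau => ~~ _)) /= -big_split /=.
  apply: ler_sum_nat => tau tauk; have := w_le k.+2 tau tauk.
  rewrite /in_o -!leqNgt; case: (leqP k.+2 (tau + d tau)) => h hw.
    rewrite (ltnW h) ge_max addr_ge0 ?subr_ge0 ?le_max ?lexx //=.
    by rewrite -lerBlDl opprB addrA subrK le_max lexx orbT.
  case: ifP => _; rewrite addr0 // ge_max subr_ge0 rk lerD2r; exact: hw.
apply: le_trans (lerD (lexx _) step) _; rewrite addrA /pot lerD2r.
have -> : \sum_(1 <= tau < k.+2 | ~~ in_o d k.+1 tau) (r k.+2 - r k.+1)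
   = (card_m d k.+1).+1%:R * (r k.+2 - r k.+1).
  rewrite big_mkcond big_nat_recr //= -big_mkcond card_m_sum.
  by rewrite ifT /in_o -?leqNgt ?leq_addr // -natr1 mulrDl mul1r.
have : (card_m d k.+1).+1%:R * (r k.+2 - r k.+1) <= s.+1%:R * (r k.+2 - r k.+1).
  by rewrite ler_wpM2r ?subr_ge0 // ler_nat ltnS card_m_le_sigma.
by rewrite mulrBr; lra.
Qed.

End Delays.

(** * The clipping threshold *)

Section Rho.
Variables (R : realType) (y : nat -> R) (d : nat -> nat).

Lemma rho_ge0 t : 0 <= rho y d t.
Proof. by rewrite /rho; elim/big_rec: _ => // i x _ x0; rewrite le_max x0 orbT. Qed.

Lemma rho_ge t tau : (1 <= tau < t)%N -> in_o d t tau -> `|y tau| <= rho y d t.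
Proof.
move=> taut o; apply: (le_bigmax_seq 0 tau (in_o d t) (fun i => `|y i|)) => //.
by rewrite mem_index_iota.
Qed.

Lemma rho_le t (Y : R) : 0 <= Y ->
  (forall tau, (1 <= tau < t)%N -> `|y tau| <= Y) -> rho y d t <= Y.
Proof.
move=> Y0 yY; rewrite /rho big_nat_cond; apply: bigmax_le => // i /andP[h _]; exact: yY.
Qed.

Lemma rho_mono t : rho y d t <= rho y d t.+1.
Proof.
apply: le_bigmax_nat_cond => // i _; rewrite /in_o => h; exact: ltnW.
Qed.

End Rho.

(** The tangent bound of the logarithm, applied to the reciprocal of [1 + x]. *)
Lemma ln1D_ge (R : realType) (x : R) : 0 <= x -> x / (1 + x) <= ln (1 + x).
Proof.
move=> x0; have x1 : 0 < 1 + x by lra.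
have : ln (1 + - (x / (1 + x))) <= - (x / (1 + x)).
  by apply: le_ln1Dx; rewrite ltrN2 ltr_pdivrMr // mul1r; lra.
have -> : 1 + - (x / (1 + x)) = (1 + x)^-1 by field; lra.
by rewrite lnV ?posrE // lerN2.
Qed.

(** * Regret of the delayed, clipped learner *)

Section Learner.
Variables (R : realType) (n T : nat) (z : nat -> 'rV[R]_n) (y : nat -> R).
Variables (d : nat -> nat) (eta : nat -> R) (Y Z : R) (x : nat -> 'rV[R]_n).
Hypothesis n_gt0 : (0 < n)%N.
Hypothesis delayT : forall t, (1 <= t <= T)%N -> (t + d t <= T)%N.
Hypothesis Y_ge0 : 0 <= Y.
Hypothesis zZ : forall t, (1 <= t <= T)%N -> sqnorm (z t) <= Z ^+ 2.
Hypothesis yY : forall t, (1 <= t <= T)%N -> `|y t| <= Y.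
Hypothesis eta0 : 0 < eta 0%N.
Hypothesis eta_le : forall t, (t < T)%N -> eta t <= eta t.+1.
Hypothesis x_min : forall t, (1 <= t <= T)%N ->
  forall x', vaw_obj z y d eta t (x t) <= vaw_obj z y d eta t x'.

Let A t := gram z (eta t) t.
Let p t := dotv (z t) (x t).
Let ps t := vaw_pred z y eta t.
Let lev t := leverage z eta t.
Let L := ln (1 + Z ^+ 2 * T%:R / (eta 0%N * n%:R)).
Let a := Z ^+ 2 * T%:R / eta 0%N.

Lemma eta_mono s t : (s <= t)%N -> (t <= T)%N -> eta s <= eta t.
Proof.
elim: t => [|t IHt]; first by rewrite leqn0 => /eqP ->.
rewrite leq_eqVlt => /orP[/eqP -> //|st] tT.
exact: le_trans (IHt st (ltnW tT)) (eta_le tT).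
Qed.

Lemma eta_gt0 t : (t <= T)%N -> 0 < eta t.
Proof. by move=> tT; apply: lt_le_trans eta0 (eta_mono (leq0n t) tT). Qed.

Lemma vaw_objE t u : vaw_obj z y d eta t u =
  (form (A t) u u - 2 * dotv (\sum_(1 <= tau < t | in_o d t tau) y tau *: z tau) u) / 2.
Proof.
rewrite /vaw_obj /A form_gram dotv_suml sumrN.
have -> : \sum_(1 <= tau < t | in_o d t tau) dotv (y tau *: z tau) u
    = \sum_(1 <= tau < t | in_o d t tau) y tau * dotv (z tau) u.
  by apply: eq_bigr => tau _; exact: dotvZl.
by field.
Qed.

Lemma learner_pred t : (1 <= t <= T)%N -> p t =
  \sum_(1 <= tau < t | in_o d t tau) y tau * form (invmx (A t)) (z tau) (z t).
Proof.
move=> tT; have /andP[_ t_le] := tT.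
have pA : posdef (A t) by apply/posdef_gram/eta_gt0.
have xE : x t = (\sum_(1 <= tau < t | in_o d t tau) y tau *: z tau) *m invmx (A t).
  by apply: quadratic_argmin pA _ => x'; have := x_min tT x'; rewrite !vaw_objE; lra.
rewrite /p xE dotvC mulmx_suml dotv_suml; apply: eq_bigr => tau _.
by rewrite -/(form _ _ _) formZl.
Qed.

Lemma full_pred t : ps t =
  \sum_(1 <= tau < t) y tau * form (invmx (A t)) (z tau) (z t).
Proof.
rewrite /ps /vaw_pred /target /form mulmx_suml dotv_suml; apply: eq_bigr => tau _.
by rewrite -/(form _ _ _) formZl.
Qed.

Let err t := \sum_(1 <= tau < t | ~~ in_o d t tau) `|form (invmx (A t)) (z tau) (z t)|.

(** Both predictions use the same coefficients, so only the missing labels survive in the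
    difference. *)
Lemma pred_err t : (1 <= t <= T)%N -> `|p t - ps t| <= Y * err t.
Proof.
move=> tT; rewrite distrC learner_pred // full_pred (bigID (in_o d t)) /= addrC addrK.
apply: le_trans (ler_norm_sum _ _ _) _; rewrite mulr_sumr !(big_mkcond (fun i => ~~ _)) /=.
apply: ler_sum_nat => tau /andP[tau1 taut]; case: ifP => // _.
rewrite normrM ler_wpM2r // yY // tau1 (leq_trans (ltnW taut)) //.
by case/andP: tT.
Qed.

Lemma form_inv_bound t tau : (1 <= t <= T)%N -> (1 <= tau <= T)%N ->
  `|form (invmx (A t)) (z tau) (z t)| <= Z ^+ 2 / eta t.
Proof.
move=> tT tauT; have et : 0 < eta t by apply: eta_gt0; case/andP: tT.
apply: le_trans (posdef_cauchy _ _ (posdef_inv (posdef_gram _ _ et))) _.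
have bound s : (1 <= s <= T)%N -> form (invmx (A t)) (z s) (z s) <= Z ^+ 2 / eta t.
  move=> sT; apply: le_trans (form_inv_gram_sqnorm _ _ _ et) _.
  by rewrite ler_wpM2r ?invr_ge0 ?(ltW et) ?zZ.
by have := bound t tT; have := bound tau tauT; rewrite /A; lra.
Qed.

Lemma lev_ge0 t : (1 <= t <= T)%N -> 0 <= lev t.
Proof.
move=> /andP[_ tT]; exact/posdef_form_ge0/posdef_inv/posdef_gram/eta_gt0.
Qed.

(** Lowering every [eta t] to [eta 0] can only raise the leverages, and a constant [eta] makes the
    determinants telescope. *)
Lemma sum_lev : \sum_(1 <= t < T.+1) lev t <= n%:R * L.
Proof.
apply: le_trans (elliptical_potential n_gt0 eta0 (sqr_ge0 Z) zZ).
apply: ler_sum_nat => t /andP[_ tT]; apply: form_inv_gram_le => //.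
exact: eta_mono.
Qed.

(** Each coefficient is split into half of [lev t], which occurs at most [d_max] times per round,
    and half of [lev tau], which [sum_missing_le] regroups by [tau]. *)
Lemma sum_err_le_d_max : \sum_(1 <= t < T.+1) err t <= (n * d_max d T)%:R * L.
Proof.
apply: (@le_trans _ _ ((d_max d T)%:R * \sum_(1 <= t < T.+1) lev t)); last first.
  by rewrite natrM [n%:R * _]mulrC -mulrA ler_wpM2l ?sum_lev.
have err_le t : (1 <= t < T.+1)%N ->
    err t <= (d_max d T)%:R * lev t / 2
             + (\sum_(1 <= tau < t | ~~ in_o d t tau) lev tau) / 2.
  rewrite ltnS => tT; have /andP[t1 t_le] := tT.
  have := card_m_le_d_max d tT; rewrite -(ler_nat R) => /(ler_wpM2r (lev_ge0 tT)) hd.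
  suff : err t <= (card_m d t)%:R * lev t / 2
             + (\sum_(1 <= tau < t | ~~ in_o d t tau) lev tau) / 2 by lra.
  rewrite -card_m_sum -mulrDl -big_split mulr_suml /err !(big_mkcond (fun i => ~~ _)) /=.
  apply: ler_sum_nat => tau /andP[tau1 taut]; case: ifP => // _.
  have et := eta_gt0 t_le.
  apply: le_trans (posdef_cauchy _ _ (posdef_inv (posdef_gram _ _ et))) _.
  (* The Gram matrix only grows between rounds [tau] and [t], so its inverse shrinks. *)
  have : form (invmx (A t)) (z tau) (z tau) <= lev tau.
    apply: form_inv_gram_le (ltnW taut); last exact: eta_mono (ltnW taut) t_le.
    exact/eta_gt0/(leq_trans (ltnW taut)).
  rewrite -/(A t) /= -/(leverage z eta t) -/(lev t); lra.
apply: le_trans (ler_sum_nat err_le) _; rewrite big_split /= -!mulr_suml -mulr_sumr.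
have := sum_missing_le d lev_ge0; lra.
Qed.

Lemma sum_err_le_card_m :
  \sum_(1 <= t < T.+1) err t <= Z ^+ 2 * \sum_(1 <= t < T.+1) (card_m d t)%:R / eta t.
Proof.
rewrite mulr_sumr; apply: ler_sum_nat => t tT.
rewrite mulrCA -card_m_sum /err !(big_mkcond (fun i => ~~ _)) /=.
apply: ler_sum_nat => tau /andP[tau1 taut]; case: ifP => // _.
apply: form_inv_bound => //; rewrite tau1 (leq_trans (ltnW taut)) //.
by case/andP: tT.
Qed.

(** The prediction has fewer than [T] summands, each an observed label times a coefficient of size
    at most [Z ^+ 2 / eta 0]. *)
Lemma pred_le_rho t : (1 <= t <= T)%N -> `|p t| <= a * rho y d t.
Proof.
move=> tT; have /andP[t1 t_le] := tT.
rewrite learner_pred //; apply: le_trans (ler_norm_sum _ _ _) _.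
have b0 : 0 <= rho y d t * (Z ^+ 2 / eta 0%N).
  by rewrite mulr_ge0 ?rho_ge0 // divr_ge0 ?sqr_ge0 // ltW.
apply: (@le_trans _ _ (\sum_(1 <= tau < t) rho y d t * (Z ^+ 2 / eta 0%N))).
  rewrite big_mkcond; apply: ler_sum_nat => tau taut; case: ifP => // o.
  have /andP[tau1 tau_lt] := taut.
  rewrite normrM ler_pM ?rho_ge //.
  apply: le_trans (form_inv_bound tT _) _; first by rewrite tau1 (leq_trans (ltnW tau_lt)).
  by rewrite ler_wpM2l ?sqr_ge0 // lef_pV2 ?posrE ?eta_gt0 // eta_mono.
rewrite sumr_const_nat -mulr_natr.
have -> : a * rho y d t = rho y d t * (Z ^+ 2 / eta 0%N) * T%:R.
  by rewrite /a; field; rewrite gt_eqF.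
by rewrite ler_wpM2l // ler_nat; lia.
Qed.

Lemma clip_ratio_ge0 : 0 <= a.
Proof. by rewrite divr_ge0 ?(ltW eta0) // mulr_ge0 ?sqr_ge0. Qed.

Lemma clip_factor_le : a / (1 + a) <= n%:R * L.
Proof.
have n1 : 1 <= n%:R :> R by rewrite ler1n.
have n0 : 0 < n%:R :> R by rewrite ltr0n.
have a0 := clip_ratio_ge0.
have LE : L = ln (1 + a / n%:R).
  by rewrite /L /a invfM mulrA.
have an0 : 0 <= a / n%:R by rewrite divr_ge0.
have an : a / n%:R <= a by rewrite ler_piMr // invf_le1.
(* Replacing [a] by [a / n] in the denominator makes the ratio [n] times the lower bound of
   [ln1D_ge] at [a / n]. *)
apply: (@le_trans _ _ (n%:R * (a / n%:R / (1 + a / n%:R)))); last first.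
  by rewrite ler_wpM2l // LE ln1D_ge.
have -> : n%:R * (a / n%:R / (1 + a / n%:R)) = a / (1 + a / n%:R).
  by field; rewrite !gt_eqF //; lra.
by rewrite ler_wpM2l // lef_pV2 ?posrE; lra.
Qed.

Lemma sum_clip_excess :
  \sum_(1 <= t < T.+1) Num.max 0 (y t ^+ 2 - rho y d t ^+ 2)
  <= (sigma_max d T).+1%:R * Y ^+ 2.
Proof.
have sq_le s t : rho y d s <= rho y d t -> rho y d s ^+ 2 <= rho y d t ^+ 2.
  by move=> st; rewrite ler_sqr ?nnegrE ?rho_ge0.
apply: (sum_unseen_excess (w := fun t => y t ^+ 2) (r := fun t => rho y d t ^+ 2)) => //.
- by move=> t _; apply/sq_le/rho_mono.
- move=> t tau taut o.
  by rewrite -[y tau ^+ 2]real_normK ?num_real // ler_sqr ?nnegrE ?rho_ge0 // rho_ge.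
- exact: sqr_ge0.
- by rewrite ler_sqr ?nnegrE ?rho_ge0 // rho_le.
Qed.

Lemma learner_regret u :
  regret T z y (fun t => clip (rho y d t) (z t) (x t)) u
  <= eta T / 2 * sqnorm u + n%:R * Y ^+ 2 * L
     + 2 * Y ^+ 2 * ((sigma_max d T)%:R
        + Num.min ((n * d_max d T)%:R * L)
                  (Z ^+ 2 * \sum_(1 <= t < T.+1) (card_m d t)%:R / eta t)).
Proof.
set M := Num.min _ _; set k := a / (1 + a).
have sum_err : \sum_(1 <= t < T.+1) err t <= M.
  by rewrite le_min sum_err_le_d_max sum_err_le_card_m.
have a0 := clip_ratio_ge0.
have k0 : 0 <= k by rewrite divr_ge0 // addr_ge0.
have k1 : k <= 1 by rewrite /k ler_pdivrMr; lra.
have kL : k <= n%:R * L := clip_factor_le.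
have step t : (1 <= t < T.+1)%N ->
    sqloss (z t) (y t) (clip (rho y d t) (z t) (x t)) - sqloss (z t) (y t) u
    <= ((ps t - y t) ^+ 2 / 2 - sqloss (z t) (y t) u) + 2 * Y ^+ 2 * err t
       + k / 2 * Num.max 0 (y t ^+ 2 - rho y d t ^+ 2).
  rewrite ltnS => tT.
  have rY : rho y d t <= Y.
    apply: rho_le => // tau /andP[h1 h2]; apply: yY; rewrite h1 (leq_trans (ltnW h2)) //.
    by case/andP: tT.
  have := clip_loss (ps t) (rho_ge0 y d t) rY (yY tT) (pred_le_rho tT) a0.
  have := ler_wpM2l Y_ge0 (pred_err tT); rewrite -/(p t) -/k {1}/sqloss; lra.
rewrite /regret; apply: le_trans (ler_sum_nat step) _.
rewrite 2!big_split /= -!mulr_sumr.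
have vaw := @vaw_regret _ _ z y eta T u eta0 eta_le.
have lev_le : \sum_(1 <= t < T.+1) y t ^+ 2 / 2 * leverage z eta t <= Y ^+ 2 / 2 * (n%:R * L).
  apply: (@le_trans _ _ (\sum_(1 <= t < T.+1) Y ^+ 2 / 2 * lev t)); last first.
    by rewrite -mulr_sumr ler_wpM2l ?sum_lev // divr_ge0 ?sqr_ge0.
  apply: ler_sum_nat => t tT; rewrite ler_wpM2r ?lev_ge0 // ler_wpM2r ?invr_ge0 //.
  by rewrite -[y t ^+ 2]real_normK ?num_real // ler_sqr ?nnegrE // yY.
have err_le : 2 * Y ^+ 2 * \sum_(1 <= t < T.+1) err t <= 2 * Y ^+ 2 * M.
  by rewrite ler_wpM2l // mulr_ge0 ?sqr_ge0.
have clip_le := ler_wpM2l k0 sum_clip_excess.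
have Y2 := sqr_ge0 Y.
have kL' : k * Y ^+ 2 <= n%:R * L * Y ^+ 2 by rewrite ler_wpM2r.
have sY : 0 <= (sigma_max d T)%:R * Y ^+ 2 by rewrite mulr_ge0.
have ks : k * ((sigma_max d T)%:R * Y ^+ 2) <= (sigma_max d T)%:R * Y ^+ 2.
  by rewrite ler_piMl.
(* Splitting [sigma_max + 1] isolates [k * Y ^+ 2 / 2]. By [kL'] it costs at most half of the
   logarithmic term; [lev_le] uses the other half. *)
rewrite -natr1 in clip_le.
rewrite /ps; lra.
Qed.

End Learner.

Theorem theorem5p2 :
  exists C : nat,
  forall (R : realType) (n T : nat) (z : nat -> 'rV[R]_n) (y : nat -> R)
    (d : nat -> nat) (eta : nat -> R) (Y Z : R) (x : nat -> 'rV[R]_n),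
    (0 < n)%N -> (0 < T)%N ->
    (forall t : nat, (1 <= t <= T)%N -> (t + d t <= T)%N) ->
    0 <= Y -> 0 <= Z ->
    (forall t : nat, (1 <= t <= T)%N -> Num.sqrt (sqnorm (z t)) <= Z) ->
    (forall t : nat, (1 <= t <= T)%N -> `|y t| <= Y) ->
    0 < eta 0%N ->
    (forall t : nat, (t < T)%N -> eta t <= eta t.+1) ->
    (forall t : nat, (1 <= t <= T)%N ->
       forall x' : 'rV[R]_n, vaw_obj z y d eta t (x t) <= vaw_obj z y d eta t x') ->
    forall u : 'rV[R]_n,
      regret T z y (fun t => clip (rho y d t) (z t) (x t)) u
      <= eta T / 2 * sqnorm u
         + n%:R * Y ^+ 2 * ln (1 + Z ^+ 2 * T%:R / (eta 0%N * n%:R))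
         + C%:R * Y ^+ 2 *
           ((sigma_max d T)%:R
            + Num.min ((n * d_max d T)%:R * ln (1 + Z ^+ 2 * T%:R / (eta 0%N * n%:R)))
                      (Z ^+ 2 * \sum_(1 <= t < T.+1) (card_m d t)%:R / eta t)).
Proof.
(* The constant is half of the factor 4 in [clip_loss], as the loss is half a square. *)
exists 2 => R n T z y d eta Y Z x n0 _ dT Y0 Z0 zZ yY eta0 eta_le x_min u.
apply: learner_regret => // t tT; rewrite -[sqnorm _]sqr_sqrtr ?sqnorm_ge0 //.
by rewrite ler_sqr ?nnegrE ?sqrtr_ge0 // zZ.
Qed.
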